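(* Let $\kappa$ and $\lambda$ be cardinals with $\omega\leq\lambda\leq\kappa$. Then $\mathsf{C}(C_p(L(\lambda,\kappa)))$ is the union of the following three classes of infinite cardinals $\mu$: $$\{\mu:\mathrm{cf}(\mu)>\kappa\}\cup\{\mu:\mathrm{cf}(\mu)>\omega\wedge\mu<\lambda\}\cup\{\mu:\mathrm{cf}(\mu)>\omega\wedge\mathrm{cf}(\mu)<\lambda\wedge\kappa<\mu\}.$$ Equivalently, an infinite cardinal $\mu$ is a caliber for $C_p(L(\lambda,\kappa))$ if and only if $\mathrm{cf}(\mu)>\omega$, $\mu\notin[\lambda,\kappa]$ and $\mathrm{cf}(\mu)\notin[\lambda,\kappa]$.
   Context: For cardinals $\omega\le\lambda\le\kappa$, the one-point $\lambda$-Lindel\''of extension $L(\lambda,\kappa)$ of the discrete space of size $\kappa$ is the set $\kappa\cup\{\kappa\}$ whose open sets are all subsets of $\kappa$ together with all sets $U\subseteq\kappa\cup\{\kappa\}$ such that $\kappa\in U$ and $|(\kappa\cup\{\kappa\})\setminus U|<\lambda$. For a Tychonoff space $X$, $C_p(X)$ is the set of continuous functions $X\to\mathbb{R}$ with the topology of pointwise convergence (the subspace topology from $\mathbb{R}^X$). An infinite cardinal $\mu$ is a caliber for a space $Z$ if for every set $I$ with $|I|=\mu$ and every indexed family $\{U_\alpha:\alpha\in I\}$ of nonempty open subsets of $Z$ there is $J\subseteq I$ with $|J|=\mu$ and $\bigcap_{\alpha\in J}U_\alpha\neq\emptyset$. $\mathsf{C}(Z)$ denotes the class of all infinite cardinals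 that are calibers for $Z$. *)

(* Defs.v *)
From HB Require Import structures.
From mathcomp Require Import all_boot all_order all_algebra.
From mathcomp Require Import all_classical all_reals.
From mathcomp Require Import wochoice topology normedtype.
Import numFieldNormedType.Exports.

Set Implicit Arguments.
Unset Strict Implicit.
Unset Printing Implicit Defensive.

Local Open Scope classical_set_scope.
Local Open Scope card_scope.

(* A cardinal is represented by any type (or set) of that cardinality; every
   notion below is invariant under [#=]. *)

Definition card_lt (T U : Type) (A : set T) (B : set U) : bool :=
  (A #<= B) && ~~ (B #<= A).

Notation "A '#<' B" := (card_lt A B)
  (at level 79, format "A  '#<'  B") : card_scope.

(* Well-orders are reflexive relations, as in [wochoice]; hence [y <> x]. *)
Definition init_seg (T : Type) (R : rel T) (x : T) : set T :=
  [set y | R y x /\ y <> x].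

(* (T, R) is order-isomorphic to the initial ordinal of cardinality |T|. *)
Definition initial_order (T : Type) (R : rel T) : Prop :=
  well_order R /\ forall x : T, init_seg R x #< [set: T].

Definition cofinal (T : Type) (R : rel T) (D : set T) : Prop :=
  forall x : T, exists2 y, D y & R x y.

Lemma card_le_of_inj (T U : Type) (A : set T) (B : set U) (f : T -> U) :
  (forall x, A x -> B (f x)) -> {in A &, injective f} -> A #<= B.
Proof.
move=> fAB fi; have /injfunPex[g] : exists2 f, set_fun A B f & set_inj A f.
  by exists f.
exact: inj_card_le.
Qed.

Lemma inj_of_card_le (T U : Type) (A : set T) (B : set U) (u0 : U) : A #<= B ->
  exists f : T -> U, (forall x, A x -> B (f x)) /\ {in A &, injective f}.
Proof.
move: B u0; elim/Ppointed : U => U B u0; first by case: (no u0).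
by move=> /pcard_leP/injfunPex[f fAB fi]; exists f.
Qed.

Lemma wo_min (T : Type) (R : rel T) (P : set T) : well_order R -> P !=set0 ->
  exists2 x, P x & forall y, P y -> R x y.
Proof.
move=> wR [x Px]; have [|z [[zP zmin] _]] := wR (mem P).
  by exists x; rewrite inE.
exists z; first by rewrite inE in zP.
by move=> y Py; apply: zmin; rewrite inE.
Qed.

Lemma wo_anti (T : Type) (R : rel T) x y :
  well_order R -> R x y -> R y x -> x = y.
Proof.
move=> wR xy yx; have refl z : R z z.
  by have [|u -> /(_ z erefl)] := @wo_min _ _ [set z] wR; first by exists z.
have [|z [_ zu]] := wR (mem [set x; y]).
  by exists x; rewrite inE /=; left.
have zx : z = x.
  apply: zu; split; first by rewrite inE; left.
  by move=> u; rewrite inE/= => -[->|->].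
have zy : z = y.
  apply: zu; split; first by rewrite inE; right.
  by move=> u; rewrite inE/= => -[->|->].
by rewrite -zx -zy.
Qed.

Lemma wo_total (T : Type) (R : rel T) x y : well_order R -> R x y \/ R y x.
Proof.
move=> wR; have [|z [] -> zu] := @wo_min _ _ [set x; y] wR.
- by exists x; left.
- by left; apply: zu; right.
- by right; apply: zu; left.
Qed.

Lemma wo_wf (T : Type) (R : rel T) :
  well_order R -> well_founded (fun y x => R y x /\ y <> x).
Proof.
move=> wR x; apply: contrapT => nx.
have [|z nz zu] := @wo_min _ _ [set x | ~ Acc (fun y x => R y x /\ y <> x) x] wR.
  by exists x.
apply: nz; constructor => y [yz neq]; apply: contrapT => ny.
by apply: neq; apply: (wo_anti wR) => //; exact: zu.
Qed.

Lemma wo_inj (T U : Type) (R : rel T) (B : set U) : well_order R ->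
  [set x | ~ (B #<= init_seg R x)] #<= B.
Proof.
move=> wR; have [->|/set0P[u0 Bu0]] := eqVneq B set0.
  have -> : [set x | ~ (@set0 U #<= init_seg R x)] = set0.
    by rewrite predeqE => x; split => //= /(_ (card_ge0 _ _)).
  exact: card_ge0.
pose step x (g : forall y, R y x /\ y <> x -> U) : U :=
  if pselect (exists u, B u /\ forall y h, g y h <> u) is left e
  then projT1 (cid e) else u0.
pose f := Fix (wo_wf wR) (fun=> U) step.
have fE x : f x = step x (fun y _ => f y).
  rewrite /f Fix_eq// => {}x g h gh; congr (step x _).
  by apply: functional_extensionality_dep => y; apply: funext => ?.
have fB x : B (f x).
  by rewrite fE /step; case: pselect => // e; case: (projT2 (cid e)).
have fS x y : ~ (B #<= init_seg R x) -> R y x -> y <> x -> f y <> f x.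
  move=> nx yx neq; rewrite [f x]fE /step; case: pselect => [e|ne].
    by have [_ /(_ y (conj yx neq))] := projT2 (cid e).
  exfalso; apply: nx; apply: card_le_trans (card_image_le f _).
  apply: subset_card_le => u Bu; apply: contrapT => nu; apply: ne.
  by exists u; split => // z h fz; apply: nu; exists z.
have fi : {in [set x | ~ (B #<= init_seg R x)] &, injective f}.
  move=> x y; rewrite !inE/= => nx ny fxy; apply: contrapT => neq.
  have [xy|yx] := wo_total x y wR; first exact: (fS y x ny xy neq).
  by apply: (fS x y nx yx) => // /esym.
by apply: (card_le_of_inj _ fi) => x _; exact: fB.
Qed.

Lemma ex_well_order (T : Type) : exists R : rel T, well_order R.
Proof.
by elim/Peq : T => T; have [R wR] := well_ordering_principle T; exists R.
Qed.

Lemma card_le_total (T U : Type) (A : set T) (B : set U) :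
  (A #<= B) \/ (B #<= A).
Proof.
have [R wR] := ex_well_order A; have AA := card_setT A.
have [[x Bx]|nB] := pselect (exists x, B #<= init_seg R x).
  by right; rewrite -(card_le_eqr AA); apply: card_le_trans Bx (card_leT _).
left; rewrite -(card_le_eql AA); apply: card_le_trans (wo_inj B wR).
by apply: subset_card_le => x _ Bx; apply: nB; exists x.
Qed.

Lemma ex_initial_order (T : Type) : exists R : rel T, initial_order R.
Proof.
have [R wR] := ex_well_order T.
have [[x Tx]|nT] := pselect (exists x, [set: T] #<= init_seg R x); last first.
  exists R; split => // x; rewrite /card_lt card_leT /=.
  by apply/negP => Tx; apply: nT; exists x.
have [|{Tx}x Tx xmin] := @wo_min _ _ [set x | [set: T] #<= init_seg R x] wR.
  by exists x.
have [g gx ginj] : exists2 g : T -> T,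
    forall y, init_seg R x (g y) & injective g.
  have [g [gx gi]] := inj_of_card_le x Tx.
  by exists g => [y|y z]; [exact: gx|apply: gi; rewrite inE].
exists (fun y z => R (g y) (g z)); split.
  move=> A [a aA]; have [|_ [b bA <-] bmin] := @wo_min _ _ (g @` [set` A]) wR.
    by exists (g a); exists a.
  exists b; split; first by split => // c cA; apply: bmin; exists c.
  move=> c [cA cmin]; apply: ginj; apply: (wo_anti wR); last exact: cmin.
  by apply: bmin; exists c.
move=> y; rewrite /card_lt card_leT /=; apply/negP => Ty.
have [gyx] := gx y; apply; apply: (wo_anti wR) => //; apply: xmin => /=.
apply: card_le_trans Ty _.
apply: (card_le_of_inj (f := g)); last by move=> ? ? _ _; exact: ginj.
by move=> z [zy nzy]; split => // /ginj.
Qed.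

Lemma card_le_wf (T : Type) (F : set (set T)) : F !=set0 ->
  exists D, F D /\ forall E, F E -> D #<= E.
Proof.
move=> [D0 FD0]; have [R wR] := ex_well_order T.
have [[x Fx]|nF] := pselect (exists x, exists2 D, F D & D #<= init_seg R x).
  have [|{Fx}x [D FD Dx] xmin] :=
      @wo_min _ _ [set x | exists2 D, F D & D #<= init_seg R x] wR.
    by exists x.
  exists D; split => // E FE; apply: card_le_trans Dx _.
  apply: card_le_trans (wo_inj E wR); apply: subset_card_le => y [yx neq] Ey.
  by apply: neq; apply: (wo_anti wR) => //; apply: xmin; exists E.
exists D0; split => // E FE; apply: card_le_trans (card_leT _) _.
apply: card_le_trans (wo_inj E wR); apply: subset_card_le => y _ Ey.
by apply: nF; exists y, E.
Qed.

Definition card_order (T : Type) : rel T := projT1 (cid (ex_initial_order T)).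

Lemma card_orderP (T : Type) : initial_order (@card_order T).
Proof. exact: projT2 (cid (ex_initial_order T)). Qed.

Lemma ex_min_cofinal (T : Type) : exists D : set T,
  cofinal (@card_order T) D /\
  forall E : set T, cofinal (@card_order T) E -> D #<= E.
Proof.
apply: card_le_wf; exists setT => x; exists x => //.
by have [] := wo_total x x (proj1 (card_orderP T)).
Qed.

(* cf |T|, given by a cofinal subset of least cardinality of the initial
   ordinal of |T|. *)
Definition cf (T : Type) : set T := projT1 (cid (ex_min_cofinal T)).

Arguments cf T : clear implicits.

Lemma cfP (T : Type) : cofinal (@card_order T) (cf T) /\
  forall E : set T, cofinal (@card_order T) E -> cf T #<= E.
Proof. exact: projT2 (cid (ex_min_cofinal T)). Qed.

Lemma card_le_setU_of_double (T U : Type) (X Y : set T) (B : set U)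
    (g : U -> bool -> U) :
    (forall t b, B t -> B (g t b)) ->
    (forall t t' b b', B t -> B t' -> g t b = g t' b' -> t = t' /\ b = b') ->
  X #<= B -> Y #<= B -> X `|` Y #<= B.
Proof.
move=> gB ginj; have [->|/set0P[x0 Xx0]] := eqVneq X set0; first by rewrite set0U.
move=> XB; have [u0 _] : B !=set0.
  by apply/set0P; apply: contraTneq XB => ->; rewrite card_le0; apply/set0P; exists x0.
move: XB => /(inj_of_card_le u0)[f [fB fi]] /(inj_of_card_le u0)[h [hB hi]].
apply: (card_le_of_inj
    (f := fun x => if pselect (X x) then g (f x) true else g (h x) false)).
  by move=> x; case: pselect => Xx [] // Yx; apply: gB; [exact: fB|exact: fB|exact: hB].
move=> x y; rewrite !inE => XYx XYy.
have Yof z : X z \/ Y z -> ~ X z -> Y z by case.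
case: pselect => Xx; case: pselect => Xy.
- move=> /(ginj _ _ _ _ (fB _ Xx) (fB _ Xy))[fxy _].
  by apply: fi; rewrite ?inE.
- by move=> /(ginj _ _ _ _ (fB _ Xx) (hB _ (Yof _ XYy Xy)))[].
- by move=> /(ginj _ _ _ _ (hB _ (Yof _ XYx Xx)) (fB _ Xy))[].
- have [Yx Yy] := (Yof _ XYx Xx, Yof _ XYy Xy).
  move=> /(ginj _ _ _ _ (hB _ Yx) (hB _ Yy))[hxy _].
  by apply: hi; rewrite ?inE.
Qed.

Lemma card_le_setU (T U : Type) (X Y : set T) (B : set U) :
  infinite_set B -> X #<= B -> Y #<= B -> X `|` Y #<= B.
Proof.
move=> Binf XB YB.
have [E [ED Edis Emax]] := ex_maximal_disjoint_subcollection
  (fun s : nat -> U => range s) [set s | injective s /\ range s `<=` B].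
pose B' : set U := \bigcup_(s in E) range s.
have B'B : B' `<=` B by move=> t [s /ED[_ sB]]; exact: sB.
have Cfin : finite_set (B `\` B').
  apply: contrapT => Cinf; have [u0 _] := infinite_setN0 Cinf.
  have [s [sC' sinj']] := inj_of_card_le u0 (iffLR (infiniteP _) Cinf).
  have sC n : (B `\` B') (s n) by exact: sC'.
  have sinj : injective s by move=> m n; apply: sinj'; rewrite inE.
  have nEs : ~ E s.
    by move=> Es; have [_] := sC 0; apply; exists s => //; exists 0.
  apply: (Emax (E `|` [set (s : nat -> U)])).
  - split; first by move=> ? ?; left.
    by move=> /(_ s) h; apply: nEs; apply: h; right.
  - move=> _ [/ED//|->]; split => // _ [n _ <-].
    by have [] := sC n.
  - move=> p q [Ep|->] [Eq|->] //.
    + exact: Edis.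
    + move=> [_ [[m _ <-] [n _ pn]]]; have [_ []] := sC n; rewrite pn.
      by exists p => //; exists m.
    + move=> [_ [[m _ <-] [n _ pn]]]; have [_ []] := sC m; rewrite -pn.
      by exists q => //; exists n.
have B'inf : infinite_set B'.
  move=> B'fin; apply: Binf; apply: (@sub_finite_set _ _ (B' `|` (B `\` B'))).
    by move=> t Bt; have [?|?] := pselect (B' t); [left|right].
  by rewrite finite_setU.
have idx t : exists sn : (nat -> U) * nat, B' t -> E sn.1 /\ sn.1 sn.2 = t.
  have [[s Es [n _ sn]]|nt] := pselect (B' t); first by exists (s, n).
  by exists ((fun=> t), 0).
pose i t := projT1 (cid (idx t)).
have iP t : B' t -> E (i t).1 /\ (i t).1 (i t).2 = t := projT2 (cid (idx t)).
pose g t (b : bool) := (i t).1 ((i t).2.*2 + b).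
have gB' t b : B' t -> B' (g t b).
  by move=> /iP[Es _]; exists (i t).1 => //; eexists.
have ginj t t' b b' : B' t -> B' t' -> g t b = g t' b' -> t = t' /\ b = b'.
  move=> /iP[Et tE] /iP[Et' tE'] gg; rewrite -tE -tE'.
  have ss : (i t).1 = (i t').1.
    apply: Edis => //; exists (g t b); split; first by eexists.
    by rewrite gg; eexists.
  move: gg; rewrite /g ss => /(proj1 (ED _ Et')) nn.
  have bb : b = b'.
    by have := congr1 odd nn; rewrite !oddD !odd_double /=; case: b b' {nn} => [] [].
  by move: nn; rewrite bb => /addIn/double_inj ->.
have BB' : B #<= B'.
  apply: (@card_le_trans _ _ _ (B' `|` (B `\` B'))).
    apply: subset_card_le => t Bt.
    by have [?|?] := pselect (B' t); [left|right].
  apply: (card_le_setU_of_double gB' ginj) => //.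
  apply: card_le_trans (iffLR (infiniteP _) B'inf).
  exact: finite_set_countable.
apply: card_le_trans (subset_card_le B'B).
by apply: (card_le_setU_of_double gB' ginj); apply: card_le_trans BB'.
Qed.

Lemma card_lt_setU (T U : Type) (X Y : set T) (L : set U) :
  infinite_set L -> X #< L -> Y #< L -> X `|` Y #< L.
Proof.
move=> Linf /andP[XL nXL] /andP[YL nYL]; rewrite /card_lt card_le_setU//=.
apply/negP => LXY.
have [Yfin|Yinf] := pselect (finite_set Y).
  have [Xfin|Xinf] := pselect (finite_set X).
    by apply: Linf; apply: (card_le_finite LXY); rewrite finite_setU.
  move/negP : nXL; apply; apply: card_le_trans LXY _; apply: card_le_setU => //.
  apply: card_le_trans (iffLR (infiniteP _) Xinf).
  exact: finite_set_countable.
have [XY|YX] := card_le_total X Y.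
  by move/negP : nYL; apply; apply: card_le_trans LXY _; exact: card_le_setU.
have Xinf : infinite_set X by move=> /(card_le_finite YX).
by move/negP : nXL; apply; apply: card_le_trans LXY _; exact: card_le_setU.
Qed.

(* L(|L|, |K|): [Some x] are the points of the discrete space, [None] is the
   added point. *)
Definition one_point_lindelof (L K : Type) (omegaL : [set: nat] #<= [set: L]) :
  Type := option K.

Definition one_point_lindelof_open (L K : Type) : set (set (option K)) :=
  [set U | U `<=` range Some \/ (U None /\ ~` U #< [set: L])].

Lemma one_point_lindelof_openT (L K : Type) : [set: nat] #<= [set: L] ->
  one_point_lindelof_open L [set: option K].
Proof.
move=> /infiniteP Linf; right; split => //; rewrite setCT /card_lt card_ge0 /=.
by apply/negP => /card_le_finite; apply: contra_not Linf; apply.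
Qed.

Lemma one_point_lindelof_openI (L K : Type) : [set: nat] #<= [set: L] ->
  setI_closed (@one_point_lindelof_open L K).
Proof.
move=> /infiniteP Linf U V [US|[UN Ult]].
  by move=> _; left => x [/US].
move=> [VS|[VN Vlt]]; first by left => x [_ /VS].
by right; split => //; rewrite setCI; exact: card_lt_setU.
Qed.

Lemma one_point_lindelof_open_bigU (L K I : Type) (U : I -> set (option K)) :
  (forall i, one_point_lindelof_open L (U i)) ->
  one_point_lindelof_open L (\bigcup_i U i).
Proof.
move=> Uo; have [[i UN]|nU] := pselect (exists i, U i None); last first.
  left => -[x|] [i _ Ui]; first by exists x.
  by exfalso; apply: nU; exists i.
have [/(_ _ UN) [//]|[_ /andP[UL nUL]]] := Uo i.
have sub : ~` (\bigcup_i U i) #<= ~` (U i).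
  by apply: subset_card_le; apply: subsetC; exact: bigcup_sup.
right; split; first by exists i.
apply/andP; split; first exact: card_le_trans UL.
by apply: contra nUL => LU; exact: card_le_trans sub.
Qed.

HB.instance Definition _ (L K : Type) (omegaL : [set: nat] #<= [set: L]) :=
  gen_eqMixin (one_point_lindelof K omegaL).
HB.instance Definition _ (L K : Type) (omegaL : [set: nat] #<= [set: L]) :=
  gen_choiceMixin (one_point_lindelof K omegaL).
HB.instance Definition _ (L K : Type) (omegaL : [set: nat] #<= [set: L]) :=
  isOpenTopological.Build (one_point_lindelof K omegaL)
    (one_point_lindelof_openT K omegaL) (one_point_lindelof_openI omegaL)
    (@one_point_lindelof_open_bigU L K).

Lemma one_point_lindelof_openE (L K : Type) (omegaL : [set: nat] #<= [set: L])
    (U : set (one_point_lindelof K omegaL)) :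
  open U <-> one_point_lindelof_open L U.
Proof. by []. Qed.

Definition Cp (X : topologicalType) (R : realType) : topologicalType :=
  set_type [set f : {ptws X -> R} | continuous (f : X -> R)].

Definition caliber (M : Type) (Z : topologicalType) : Prop :=
  forall (I : Type) (U : I -> set Z), [set: I] #= [set: M] ->
    (forall i, open (U i)) -> (forall i, U i !=set0) ->
    exists J : set I, J #= [set: M] /\ \bigcap_(i in J) U i !=set0.

(* The class of calibers of Z.  A class of cardinals is a predicate on [Type]
   rather than a [set Type], which would force the cardinals into a universe
   strictly below that of [set]. *)
Definition calibers (Z : topologicalType) (M : Type) : Prop :=
  infinite_set [set: M] /\ caliber M Z.

(* Main.v *)
Require Import Defs.
From mathcomp Require Import all_boot all_order all_algebra.
From mathcomp Require Import all_classical all_reals.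
From mathcomp Require Import wochoice topology normedtype.

(** Write X for L(lambda, kappa) and oo for its added point.  Everything rests
    on one observation: a real function on X that takes the value at oo outside
    a set of fewer than lambda points is continuous ([continuous_of_lt]), and a
    continuous function stays in any given neighbourhood of its value at oo
    outside a set of fewer than lambda points ([lt_of_continuous]).

    Necessity.  If cf(mu) is countable, split mu into countably many pieces of
    smaller size and give the members of the n-th piece the open set of the
    functions close to n at a fixed point; functions close to different integers
    are different, so no mu of these sets meet ([nat_lt_cf_of_caliber]).
    Next, suppose that h maps mu to kappa and that h maps every subset of
    size mu onto a set of size at least lambda.  The sets of functions that are
    large at h(m) and small at oo witness that mu is not a caliber, since a
    common element of mu of them would be large at lambda points
    ([not_caliber_of_map]).  When mu lies in [lambda, kappa], an injection is
    such an h; when cf(mu) does, one sends m to an element above m of a cofinal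
    set of size cf(mu), and injects that set into kappa
    ([caliber_not_between], [caliber_cf_not_between]).

    Sufficiency.  A nonempty open set contains every continuous extension of
    some finite partial function with rational values ([Cp_open_data]), so the
    task is to find, among mu finite partial functions, mu with a common
    continuous extension.  Fewer than lambda pairwise compatible ones always
    have such an extension: let it be constant off their domains
    ([extendable_of_lt]).  A Delta-system type argument finds mu pairwise
    compatible functions among any mu, as soon as cf(mu) is uncountable
    ([compatible_subfamily]); this settles mu < lambda.  When kappa < mu there
    are only kappa < mu distinct finite partial functions, and then the search
    for a good subfamily of size mu reduces to the one for families of size
    cf(mu) ([cf_lift]): among mu members, one finds cf(mu) values whose
    multiplicities add up to mu.  For families of size cf(mu), either
    kappa < cf(mu) and a single value is repeated cf(mu) times, or
    cf(mu) < lambda and the preceding case applies.  The same reduction also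
    gives the singular case of [compatible_subfamily]. *)

Import Order.TTheory GRing.Theory Num.Theory.
Import numFieldNormedType.Exports.

Set Implicit Arguments.
Unset Strict Implicit.
Unset Printing Implicit Defensive.

Local Open Scope ring_scope.
Local Open Scope classical_set_scope.
Local Open Scope card_scope.

(** * Cardinal arithmetic *)

Lemma card_ltNge (T U : Type) (A : set T) (B : set U) :
  (A #< B) = ~~ (B #<= A).
Proof.
rewrite /card_lt; case: (boolP (B #<= A)) => [_|nBA]; first by rewrite andbF.
by have [->|BA] := card_le_total A B; last rewrite BA in nBA.
Qed.

Lemma card_ltP (T U : Type) (A : set T) (B : set U) :
  reflect (~ (B #<= A)) (A #< B).
Proof. by rewrite card_ltNge; apply: negP. Qed.

Lemma card_ltW (T U : Type) (A : set T) (B : set U) : A #< B -> A #<= B.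
Proof. by move=> /andP[]. Qed.

Lemma card_le_lt_trans (T U V : Type) (A : set T) (B : set U) (C : set V) :
  A #<= B -> B #< C -> A #< C.
Proof.
move=> AB /card_ltP BC; apply/card_ltP => CA; apply: BC.
exact: card_le_trans CA AB.
Qed.

Lemma card_lt_le_trans (T U V : Type) (A : set T) (B : set U) (C : set V) :
  A #< B -> B #<= C -> A #< C.
Proof.
move=> /card_ltP AB BC; apply/card_ltP => CA; apply: AB.
exact: card_le_trans BC CA.
Qed.

Lemma card_lt_trans (T U V : Type) (A : set T) (B : set U) (C : set V) :
  A #< B -> B #< C -> A #< C.
Proof. by move=> /card_ltW; exact: card_le_lt_trans. Qed.

Lemma nat_lt_infinite (T : Type) (A : set T) :
  [set: nat] #< A -> infinite_set A.
Proof. by move=> /card_ltW/infiniteP. Qed.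

Lemma infinite_card_le (T U : Type) (A : set T) (B : set U) :
  A #<= B -> infinite_set A -> infinite_set B.
Proof. by move=> AB Ainf /(card_le_finite AB). Qed.

Lemma finite_lt_infinite (T U : Type) (A : set T) (B : set U) :
  finite_set A -> infinite_set B -> A #< B.
Proof. by move=> Afin Binf; apply/card_ltP => /card_le_finite/(_ Afin). Qed.

Lemma wo_refl (T : Type) (R : rel T) x : well_order R -> R x x.
Proof. by move=> wR; have [] := wo_total x x wR. Qed.

Lemma wo_trans (T : Type) (R : rel T) x y z :
  well_order R -> R x y -> R y z -> R x z.
Proof.
move=> wR xy yz; have [|u uP umin] := @wo_min _ _ [set x; y; z] wR.
  by exists x; left; left.
have ux : R u x by apply: umin; left; left.
have uy : R u y by apply: umin; left; right.
have uz : R u z by apply: umin; right.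
case: uP => [[]|] uE; rewrite uE in ux uy uz => //.
- by rewrite (wo_anti wR xy ux).
- by rewrite -(wo_anti wR yz uy).
Qed.

Section max_order.
Context {T : Type} (R : rel T) (W : rel (T * T)).
Hypotheses (wR : well_order R) (wW : well_order W).

Let mx (p : T * T) : T := if R p.1 p.2 then p.2 else p.1.

(** Pairs are compared by their maximum first and then by an arbitrary
    well-order [W], so that all pairs before [p] lie in a square whose side is
    an initial segment of [R]. *)
Definition max_order (p q : T * T) : bool :=
  `[< (R (mx p) (mx q) /\ mx p <> mx q) \/ (mx p = mx q /\ W p q) >].

Lemma max_order_wo : well_order max_order.
Proof.
apply: antisymmetric_well_order.
  move=> p q /andP[/asboolP[[pq npq]|[epq pq]] /asboolP[[qp nqp]|[eqp qp]]].
  - by case: npq; exact: (wo_anti wR).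
  - by case: npq.
  - by case: nqp.
  - exact: (wo_anti wW).
move=> A [a aA]; have [|_ [b bA <-] bmin] := @wo_min _ _ (mx @` [set` A]) wR.
  by exists (mx a); exists a.
have [|c [cA cb] cmin] := @wo_min _ _ [set p | p \in A /\ mx p = mx b] wW.
  by exists b.
exists c; split => // q qA; apply/asboolP.
have [qb|nqb] := pselect (mx q = mx b).
  by right; rewrite cb qb; split => //; exact: cmin.
by left; rewrite cb; split; [apply: bmin; exists q|move=> /esym].
Qed.

Lemma max_order_init p :
  init_seg max_order p `<=` [set x | R x (mx p)] `*` [set x | R x (mx p)].
Proof.
have mxR q : R q.1 (mx q) /\ R q.2 (mx q).
  rewrite /mx; case: ifP => [qq|nqq]; first by split => //; exact: wo_refl.
  by split; [exact: wo_refl|have [] := wo_total q.1 q.2 wR; rewrite ?nqq].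
move=> q [/asboolP qp _]; have qpR : R (mx q) (mx p).
  by case: qp => [[]|[-> _]] //; exact: wo_refl.
by have [q1 q2] := mxR q; split; exact: wo_trans qpR.
Qed.

End max_order.

Lemma init_segS (T : Type) (R : rel T) x :
  [set y | R y x] `<=` init_seg R x `|` [set x].
Proof.
by move=> y yx; have [->|yneq] := pselect (y = x); [right|left].
Qed.

Lemma initial_order_lt (T : Type) (R : rel T) x : infinite_set [set: T] ->
  initial_order R -> [set y | R y x] #< [set: T].
Proof.
move=> Tinf [wR iR].
apply: card_le_lt_trans (subset_card_le (@init_segS _ R x)) _.
by apply: (card_lt_setU Tinf (iR x)); exact: finite_lt_infinite.
Qed.

Lemma card_setX_le2 (T U T' U' : Type) (A : set T) (B : set U) (A' : set T')
    (B' : set U') : A #<= A' -> B #<= B' -> A `*` B #<= A' `*` B'.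
Proof.
move=> AA BB; have [->|/set0P[[a b] [/= Aa Bb]]] := eqVneq (A `*` B) set0.
  exact: card_ge0.
have [a' A'a'] : A' !=set0.
  apply/set0P; apply/eqP => A'0; move: AA; rewrite A'0 card_le0 => /eqP A0.
  by rewrite A0 in Aa.
have [b' B'b'] : B' !=set0.
  apply/set0P; apply/eqP => B'0; move: BB; rewrite B'0 card_le0 => /eqP B0.
  by rewrite B0 in Bb.
have [f [fA fi]] := inj_of_card_le a' AA.
have [g [gB gi]] := inj_of_card_le b' BB.
apply: (card_le_of_inj (f := fun p => (f p.1, g p.2))).
  by move=> p [? ?]; split; [exact: fA|exact: gB].
move=> [x y] [z t]; rewrite !inE => -[/= Ax By] [/= Az Bt] [fxz gyt].
congr (_, _); first exact: fi (mem_set Ax) (mem_set Az) fxz.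
exact: gi (mem_set By) (mem_set Bt) gyt.
Qed.

(** In a counterexample [D] of least cardinality, ordered as an initial ordinal,
    every initial segment of [D * D] for [max_order] lies in a square whose side
    is smaller than [D]; that square is again smaller than [D] by minimality,
    and a well-order all of whose initial segments are smaller than [D] embeds
    in [D]. *)
Lemma card_sqr_le (T : Type) (A : set T) : infinite_set A -> A `*` A #<= A.
Proof.
move=> Ainf; apply: contrapT => nA.
have [|D [[Dinf nD] Dmin]] :=
    @card_le_wf T [set D | infinite_set D /\ ~ (D `*` D #<= D)].
  by exists A.
have DD := card_setT D.
have Tinf : infinite_set [set: D].
  by apply: infinite_card_le Dinf; rewrite (card_le_eqr DD).
have [W wW] := ex_well_order (D * D)%type.
have iR := @card_orderP D; have [wR _] := iR.
have wG := max_order_wo wR wW.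
apply: nD; apply: (@card_le_trans _ _ _ ([set: D] `*` [set: D])).
  by apply: card_setX_le2; rewrite (card_le_eqr DD).
rewrite -(card_le_eqr DD); apply: card_le_trans (wo_inj [set: D] wG).
apply: subset_card_le => p _ /= Dp.
set m := if card_order p.1 p.2 then p.2 else p.1.
have {}Dp : [set: D] #<= [set x | card_order x m] `*` [set x | card_order x m].
  apply: card_le_trans Dp (subset_card_le _); exact: max_order_init.
have mlt : [set x | card_order x m] #< [set: D] by exact: initial_order_lt.
have [mfin|minf] := pselect (finite_set [set x | card_order x m]).
  by apply: Tinf; apply: (card_le_finite Dp); exact: finite_setX.
set E := [set val x | x in [set x | card_order x m]].
have mm : E #= [set x | card_order x m].
  by apply: inj_card_eq; exact: in2W val_inj.
move/card_ltP : mlt; apply; rewrite (card_le_eql DD).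
rewrite -(card_le_eqr mm); apply: Dmin; split.
  by apply: infinite_card_le minf; rewrite (card_le_eqr mm).
move=> EE; have : [set: D] #<= E.
  apply: (card_le_trans Dp); apply: card_le_trans EE; apply: card_setX_le2;
  by rewrite (card_le_eqr mm).
by rewrite (card_le_eqr mm); exact/card_ltP/initial_order_lt.
Qed.

Lemma card_setX_le (T U V : Type) (A : set T) (B : set U) (C : set V) :
  infinite_set C -> A #<= C -> B #<= C -> A `*` B #<= C.
Proof.
move=> Cinf AC BC; apply: card_le_trans (card_sqr_le Cinf).
exact: card_setX_le2.
Qed.

Lemma card_setX_lt (T U V : Type) (A : set T) (B : set U) (N : set V) :
  infinite_set N -> A #< N -> B #< N -> A `*` B #< N.
Proof.
move=> Ninf AN BN.
have [Afin|Ainf] := pselect (finite_set A).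
  have [Bfin|Binf] := pselect (finite_set B).
    by apply: finite_lt_infinite => //; exact: finite_setX.
  apply: card_le_lt_trans BN; apply: card_setX_le => //.
  exact/card_ltW/finite_lt_infinite.
have [AB|BA] := card_le_total A B.
  apply: card_le_lt_trans BN; apply: card_setX_le => //.
  exact: infinite_card_le Ainf.
by apply: card_le_lt_trans AN; exact: card_setX_le.
Qed.

Definition seqs (E : eqType) (B : set E) : set (seq E) :=
  [set s | forall e, e \in s -> B e].

(** Folding a pairing function of [C] along a list gives a code in [C], which
    determines the list once its length is known. *)
Lemma card_seqs_le (E : eqType) (U : Type) (B : set E) (C : set U) :
  infinite_set C -> B #<= C -> seqs B #<= C.
Proof.
move=> Cinf BC; have [c0 Cc0] := infinite_setN0 Cinf.
have [f [fC fi]] := inj_of_card_le c0 BC.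
have [g [gC gi]] := inj_of_card_le c0 (card_sqr_le Cinf).
pose code (s : seq E) := foldr (fun e u => g (f e, u)) c0 s.
have codeC s : seqs B s -> C (code s).
  elim: s => [//|e s IH] Bes; apply: gC; split => /=.
    by apply/fC/Bes; rewrite mem_head.
  by apply: IH => x xs; apply: Bes; rewrite in_cons xs orbT.
have code_inj s t : seqs B s -> seqs B t -> size s = size t ->
    code s = code t -> s = t.
  elim: s t => [|e s IH] [|e' t] //= Bs Bt [st] gg.
  have [Be Be'] : B e /\ B e' by split; [apply: Bs|apply: Bt]; rewrite mem_head.
  have [Bs' Bt'] : seqs B s /\ seqs B t.
    by split=> x xs; [apply: Bs|apply: Bt]; rewrite in_cons xs orbT.
  have [fe cc] : (f e, code s) = (f e', code t).
    apply: gi => //; apply: mem_set; split => /=; do ?exact: fC.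
      exact: codeC.
    exact: codeC.
  by rewrite (IH t)// (fi e e')//; exact: mem_set.
apply: (@card_le_trans _ _ _ ([set: nat] `*` C)).
  apply: (card_le_of_inj (f := fun s => (size s, code s))).
    by move=> s Bs; split => //; exact: codeC.
  by move=> s t /set_mem Bs /set_mem Bt [st cc]; exact: code_inj.
by apply: card_setX_le => //; exact/infiniteP.
Qed.

Lemma card_seqs_lt (E : eqType) (U : Type) (B : set E) (N : set U) :
  [set: nat] #< N -> B #< N -> seqs B #< N.
Proof.
move=> natN BN; have [Bnat|natB] := card_le_total B [set: nat].
  apply: card_le_lt_trans natN; apply: card_seqs_le => //.
  exact: infinite_nat.
by apply: card_le_lt_trans BN; apply: card_seqs_le => //; exact/infiniteP.
Qed.

(** * Cofinality *)

Section cofinality.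
Context {M : Type}.

Let wR : well_order (@card_order M) := proj1 (card_orderP M).

(** A set of fewer than cf(mu) elements cannot be cofinal, and in a total order
    a set that is not cofinal is bounded. *)
Lemma lt_cf_bounded (E : set M) : E #< cf M ->
  exists x, forall y, E y -> init_seg (@card_order M) x y.
Proof.
move=> /card_ltP Ecf; apply: contrapT => nx; apply: Ecf; apply: (cfP M).2 => x.
apply: contrapT => nE; apply: nx; exists x => y Ey.
have nxy : ~ card_order x y by move=> xy; apply: nE; exists y.
split; first by have [] := wo_total x y wR.
by move=> yx; apply: nxy; rewrite yx; exact: wo_refl.
Qed.

Lemma le_init_seg (U : Type) (B : set U) : B #< [set: M] ->
  exists x, B #<= init_seg (@card_order M) x.
Proof.
move=> /card_ltP BM; apply: contrapT => nB; apply: BM.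
apply: card_le_trans (wo_inj B wR); apply: subset_card_le => x _ Bx.
by apply: nB; exists x.
Qed.

Lemma cf_above : exists h : M -> M, forall m, cf M (h m) /\ card_order m (h m).
Proof.
have above m : exists c, cf M c /\ card_order m c.
  by have [c] := (cfP M).1 m; exists c.
by have [h hP] := choice above; exists h.
Qed.

Lemma full_not_le (J : set M) x : infinite_set [set: M] -> J #= [set: M] ->
  ~ (J `<=` [set m | card_order m x]).
Proof.
move=> Minf JM Jx; have /card_ltP := initial_order_lt x Minf (card_orderP M).
by apply; rewrite -(card_le_eql JM); exact: subset_card_le.
Qed.

(** Regularity of cf(mu): if every fiber were smaller than cf(mu), each would be
    bounded in [M], and so would be the set of these bounds, hence [cf M]. *)
Lemma cf_fiber (D : Type) (f : M -> D) : f @` cf M #< cf M ->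
  exists d, cf M #<= cf M `&` f @^-1` [set d].
Proof.
move=> fcf; apply: contrapT => nd.
have bd d : exists x, forall y, (cf M `&` f @^-1` [set d]) y ->
    init_seg (@card_order M) x y.
  by apply: lt_cf_bounded; apply/card_ltP => ?; apply: nd; exists d.
have [b bP] := choice bd.
have [|x xP] := @lt_cf_bounded (b @` (f @` cf M)).
  by apply: card_le_lt_trans fcf; exact: card_image_le.
have [c cfc xc] := (cfP M).1 x.
have [cb _] := bP (f c) c (conj cfc erefl).
have [|bx neq] := xP (b (f c)); first by exists (f c) => //; exists c.
by apply: neq; apply: (wo_anti wR) => //; exact: wo_trans cb.
Qed.

(** The order type of the subset [cf M] of [M] can exceed its cardinality, so
    that a subset of full size need not be cofinal.  The map [b] repairs this:
    it sends [c] to an upper bound in [M] of the elements up to [c] in an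
    enumeration of [cf M] along the initial ordinal of its cardinality. *)
Lemma cf_scale : infinite_set (cf M) ->
  exists b : M -> M, forall J, J `<=` cf M -> cf M #<= J ->
    cofinal (@card_order M) (b @` J).
Proof.
move=> cfinf; have Cinf : infinite_set [set: cf M].
  by apply: infinite_card_le cfinf; rewrite (card_le_eqr (card_setT _)).
have wC := proj1 (card_orderP (cf M)).
have bd (c : M) : exists x, forall d : cf M, forall ccf : cf M c,
    card_order d (SigSub (mem_set ccf)) -> card_order (val d) x.
  have [ccf|nccf] := pselect (cf M c); last by exists c => d ccf.
  have [|x xP] := @lt_cf_bounded
      [set val d | d in [set d : cf M | card_order d (SigSub (mem_set ccf))]].
    apply: card_le_lt_trans (card_image_le _ _) _.
    apply: card_lt_le_trans (initial_order_lt _ Cinf (card_orderP _)) _.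
    by rewrite (card_le_eql (card_setT _)).
  exists x => d ccf' dc; apply: (xP (val d) _).1; exists d => //=.
  by rewrite (Prop_irrelevance ccf ccf').
have [b bP] := choice bd; exists b => J Jcf cfJ x.
have [c ccf xc] := (cfP M).1 x.
pose c' : cf M := SigSub (mem_set ccf).
have [d Jd cd] : exists2 d : cf M, J (val d) & card_order c' d.
  apply: contrapT => nJ.
  have /card_ltP := initial_order_lt c' Cinf (card_orderP (cf M)); apply.
  rewrite (card_le_eql (card_setT _)).
  apply: (card_le_trans cfJ).
  apply: card_le_trans (card_image_le val _); apply: subset_card_le => y Jy.
  exists (SigSub (mem_set (Jcf y Jy))) => //=.
  have [//|c'y] := wo_total (SigSub (mem_set (Jcf y Jy))) c' wC.
  by exfalso; apply: nJ; eexists; last exact: c'y.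
exists (b (val d)); first by exists (val d).
apply: (wo_trans wR xc).
have dcf : cf M (val d) by exact: set_mem (valP d).
apply: (bP (val d) c' dcf).
by rewrite (_ : SigSub _ = d)//; exact: val_inj.
Qed.

End cofinality.

Lemma cf_fiber_le (M I D : Type) (A : set I) (f : I -> D) :
    infinite_set (cf M) -> cf M #<= A -> f @` A #< cf M ->
  exists d, cf M #<= A `&` f @^-1` [set d].
Proof.
move=> cfinf cfA fA; have [i0 _] := infinite_setN0 (infinite_card_le cfA cfinf).
have [h [hA hi]] := inj_of_card_le i0 cfA.
have [|d cfd] := @cf_fiber M D (f \o h).
  apply: card_le_lt_trans fA; apply: subset_card_le => _ [m /hA Am <-].
  by exists (h m).
exists d; apply: (card_le_trans cfd); apply: (card_le_of_inj (f := h)).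
  by move=> m [/hA Am fm].
by move=> m n /set_mem[cfm _] /set_mem[cfn _]; apply: hi; exact: mem_set.
Qed.

(** A family of size mu with fewer than mu distinct values contains, for every
    [m] in [M], a value whose multiplicity exceeds the size of the initial
    segment of [m].  Choosing such values along a cofinal set gives a family of
    size cf(mu) in which any subfamily of full size still has multiplicities
    that add up to mu. *)
Lemma cf_lift (M I D : Type) (P : set (set D)) (A : set I) (p : I -> D) :
    infinite_set (cf M) -> (forall X Y, X `<=` Y -> P Y -> P X) ->
    [set: M] #<= A -> p @` A #< [set: M] ->
    (forall d : M -> D, (forall m, (p @` A) (d m)) ->
      exists J, [/\ J `<=` cf M, cf M #<= J & P (d @` J)]) ->
  exists J, [/\ J `<=` A, [set: M] #<= J & P (p @` J)].
Proof.
move=> cfinf Pdown MA pA cfP'.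
have Minf : infinite_set [set: M] by exact: infinite_card_le (card_leT _) cfinf.
pose fiber d := A `&` p @^-1` [set d].
have big m : exists d, (p @` A) d /\ ~ (fiber d #<= init_seg (@card_order M) m).
  apply: contrapT => nd.
  have le d : (p @` A) d -> fiber d #<= init_seg (@card_order M) m.
    by move=> Ad; apply: contrapT => nle; apply: nd; exists d.
  have inj d : exists h : I -> M, (p @` A) d ->
      (forall i, fiber d i -> init_seg (@card_order M) m (h i)) /\
      {in fiber d &, injective h}.
    have [/le/(inj_of_card_le m)[h hP]|nAd] := pselect ((p @` A) d).
      by exists h.
    by exists (fun=> m).
  have [h hP] := choice inj.
  (* Otherwise [A] would embed in the product of the set of values and the
     initial segment of [m], both smaller than [M]. *)
  have /card_ltP := card_setX_lt Minf pA (proj2 (card_orderP M) m); apply.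
  apply: (card_le_trans MA).
  apply: (card_le_of_inj (f := fun i => (p i, h (p i) i))).
    move=> i Ai; have [|hi _] := hP (p i); first by exists i.
    by split; [exists i|exact: hi].
  move=> i j /set_mem Ai /set_mem Aj [pij]; rewrite -pij.
  have [|_ hi] := hP (p i); first by exists i.
  by apply: hi; apply: mem_set; split.
have [d dP] := choice big; have [b bcof] := cf_scale cfinf.
have [|J [Jcf cfJ PJ]] := cfP' (d \o b); first by move=> m; have [] := dP (b m).
exists (\bigcup_(c in J) fiber (d (b c))); split.
- by move=> i [c _ []].
- (* If this union were smaller than [M], it would be at most as large as some
     initial segment, hence smaller than one of the fibers it contains. *)
  apply: contrapT => /card_ltP Jlt; have [x Jx] := le_init_seg Jlt.
  have [_ [c Jc <-] xbc] := bcof _ Jcf cfJ x.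
  have [_] := dP (b c); apply; apply: card_le_trans (card_le_trans Jx _).
    by apply: subset_card_le => i ?; exists c.
  apply: subset_card_le => y [yx neq]; have wR := proj1 (card_orderP M).
  split; first exact: wo_trans xbc.
  by move=> ybc; apply: neq; apply: (wo_anti wR) => //; rewrite ybc.
- by apply: Pdown PJ => _ [i [c Jc [_ pi]] <-]; exists c => //; rewrite pi.
Qed.

(** * Compatible families of finite partial functions *)

(** A finite partial function from [T] to [V] is given by the list of its
    argument-value pairs; a list is the graph of a function when the singleton
    of that list is compatible. *)
Definition compatible (T V : eqType) (X : set (seq (T * V))) : Prop :=
  forall p q, X p -> X q -> forall x a b, (x, a) \in p -> (x, b) \in q -> a = b.

Lemma sub_compatible (T V : eqType) (X Y : set (seq (T * V))) :
  X `<=` Y -> compatible Y -> compatible X.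
Proof. by move=> XY Yc p q /XY Yp /XY Yq; exact: Yc. Qed.

Definition domain (T V : eqType) (Y : set (seq (T * V))) : set T :=
  \bigcup_(p in Y) [set x | exists a, (x, a) \in p].

Lemma domain_lt (T V : eqType) (U : Type) (N : set U) (Y : set (seq (T * V))) :
  [set: nat] #< N -> Y #< N -> domain Y #< N.
Proof.
move=> natN YN; have Ninf := nat_lt_infinite natN.
have [->|/set0P[x0 _]] := eqVneq (domain Y) set0.
  by apply: finite_lt_infinite => //; exact: finite_set0.
apply: card_le_lt_trans (card_setX_lt Ninf YN natN).
apply: card_le_trans (card_image_le (fun z => nth x0 (map fst z.1) z.2) _).
apply: subset_card_le => x [p Yp [a xa]]; exists (p, index (x, a) p) => //=.
by rewrite (nth_map (x, a)) ?index_mem// nth_index.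
Qed.

(** The combinatorial core, by induction on a common bound for the sizes of the
    domains.  A maximal subfamily with disjoint domains is pairwise compatible,
    so it may be assumed smaller than [N]; then the union [S] of its domains is
    smaller than [N] and meets all the other domains.  The restrictions to [S]
    take fewer than [N] values, which the last hypothesis handles, and the
    restrictions to the complement of [S] have strictly smaller domains. *)
Lemma compatible_subfamily_of_small (T : eqType) (V : countType) (U I : Type)
    (N : set U) :
    [set: nat] #< N ->
    (forall (A : set I) (f : I -> nat), N #<= A ->
      exists n, N #<= A `&` f @^-1` [set n]) ->
    (forall (A : set I) (p : I -> seq (T * V)), N #<= A -> p @` A #< N ->
      (forall i, A i -> compatible [set p i]) ->
      exists J, [/\ J `<=` A, N #<= J & compatible (p @` J)]) ->
  forall (A : set I) (p : I -> seq (T * V)), N #<= A ->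
    (forall i, A i -> compatible [set p i]) ->
  exists J, [/\ J `<=` A, N #<= J & compatible (p @` J)].
Proof.
move=> natN pigeon small A p NA pc; have Ninf := nat_lt_infinite natN.
have [n Nn] := pigeon A (size \o p) NA.
suff: exists J, [/\ J `<=` A `&` (size \o p) @^-1` [set n], N #<= J &
    compatible (p @` J)].
  by move=> [J [Jn NJ Jc]]; exists J; split => // i /Jn[].
have : forall i, (A `&` (size \o p) @^-1` [set n]) i -> (size (p i) <= n)%N.
  by move=> i [_ /= ->].
have : forall i, (A `&` (size \o p) @^-1` [set n]) i -> compatible [set p i].
  by move=> i [/pc].
move: (A `&` _) Nn => {NA pc}A; elim: n A p => [|n IH] A p NA pc psize.
  exists A; split => // _ q [i Ai <-] _ x a b.
  by have := psize i Ai; rewrite leqn0 size_eq0 => /eqP ->.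
pose dom i : set T := [set x | exists a, (x, a) \in p i].
have [E [EA Edis Emax]] := ex_maximal_disjoint_subcollection dom A.
have [NE|nNE] := pselect (N #<= E).
  exists E; split => // _ _ [i Ei <-] [j Ej <-] x a b xa xb.
  have ij : i = j by apply: Edis => //; exists x; split; [exists a|exists b].
  by apply: (pc i (EA i Ei) (p i) (p j) _ _ x) => //; rewrite ij.
have {}nNE : E #< N by exact/card_ltP.
pose S := domain (p @` E).
have SN : S #< N.
  by apply: domain_lt => //; apply: card_le_lt_trans nNE; exact: card_image_le.
pose inS := (fun e : T * V => `[< S e.1 >]).
pose q i := seq.filter inS (p i); pose r i := seq.filter (predC inS) (p i).
have NAE : N #<= A `\` E.
  apply: contrapT => /card_ltP AEN.
  have /card_ltP := card_lt_setU Ninf nNE AEN; apply; apply: (card_le_trans NA).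
  apply: subset_card_le => i Ai.
  by have [Ei|nEi] := pselect (E i); [left|right].
have meetS i : (A `\` E) i -> exists2 e, e \in p i & inS e.
  move=> [Ai nEi]; apply: contrapT => nS; apply: (Emax (E `|` [set i])).
  - split; first by move=> j; left.
    by move=> /(_ i) h; apply/nEi/h; right.
  - by move=> j [/EA|->].
  - have nonmeet j x : E j -> dom i x -> ~ dom j x.
      move=> Ej [a xa] jx; apply: nS; exists (x, a) => //.
      by apply/asboolP; exists (p j) => //; exists j.
    move=> j k [Ej|->] [Ek|->] //; first exact: Edis.
    + by move=> [x [jx ix]]; have := nonmeet j x Ej ix.
    + by move=> [x [ix kx]]; have := nonmeet k x Ek ix.
have qA : q @` (A `\` E) #< N.
  apply: card_le_lt_trans (subset_card_le _)
    (card_seqs_lt (B := S `*` [set: V]) natN _).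
    move=> _ [i _ <-] e; rewrite mem_filter => /andP[/asboolP Se _].
    by split.
  apply: card_setX_lt => //; apply: card_le_lt_trans natN; exact: countableP.
have qc i : (A `\` E) i -> compatible [set q i].
  move=> [Ai _] _ _ -> -> x a b; rewrite !mem_filter => /andP[_ xa] /andP[_ xb].
  exact: (pc i Ai _ _ erefl erefl x).
have [J1 [J1A NJ1 qJ1]] := small _ _ NAE qA qc.
have [||J [JJ1 NJ rJ]] := IH J1 r NJ1.
- move=> i /J1A[Ai _] _ _ -> -> x a b.
  rewrite !mem_filter => /andP[_ xa] /andP[_ xb].
  exact: (pc i Ai _ _ erefl erefl x).
- move=> i /J1A AEi; have [e ep eS] := meetS i AEi.
  rewrite -ltnS; apply: leq_trans (psize i AEi.1).
  rewrite size_filter -(count_predC inS (p i)) -[X in (X < _)%N]add0n ltn_add2r.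
  by rewrite -has_count; apply/hasP; exists e.
exists J; split => //; first by move=> i /JJ1/J1A[].
move=> _ _ [i Ji <-] [j Jj <-] x a b xa xb.
have [Sx|nSx] := pselect (S x).
- have [J1i J1j] := (JJ1 i Ji, JJ1 j Jj).
  apply: (qJ1 (q i) (q j) _ _ x); [by exists i|by exists j| |];
  by rewrite mem_filter ?xa ?xb andbT; apply/asboolP.
- apply: (rJ (r i) (r j) _ _ x); [by exists i|by exists j| |];
  by rewrite mem_filter ?xa ?xb andbT; apply/asboolP.
Qed.

(** As cf(mu) is regular, a family of size cf(mu) with fewer than cf(mu) values
    has one value repeated cf(mu) times. *)
Lemma compatible_subfamily_cf (T : eqType) (V : countType) (M I : Type)
    (A : set I) (p : I -> seq (T * V)) :
    [set: nat] #< cf M -> cf M #<= A ->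
    (forall i, A i -> compatible [set p i]) ->
  exists J, [/\ J `<=` A, cf M #<= J & compatible (p @` J)].
Proof.
move=> natcf; have cfinf := nat_lt_infinite natcf.
move: A p; apply: (compatible_subfamily_of_small natcf).
  move=> A f cfA; apply: cf_fiber_le => //.
  exact: card_le_lt_trans (card_leT _) natcf.
move=> A p cfA pA pc; have [d cfd] := cf_fiber_le cfinf cfA pA.
exists (A `&` p @^-1` [set d]); split=> //.
have [i [Ai pid]] := infinite_setN0 (infinite_card_le cfd cfinf).
by apply: sub_compatible (pc i Ai) => _ [j [_ pjd] <-] /=; rewrite pid -pjd.
Qed.

(** For singular mu the regularity argument fails, but [cf_lift] reduces
    families with fewer than mu values to families of size cf(mu). *)
Lemma compatible_subfamily (T : eqType) (V : countType) (M I : Type)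
    (A : set I) (p : I -> seq (T * V)) :
    [set: nat] #< cf M -> [set: M] #<= A ->
    (forall i, A i -> compatible [set p i]) ->
  exists J, [/\ J `<=` A, [set: M] #<= J & compatible (p @` J)].
Proof.
move=> natcf; have cfinf := nat_lt_infinite natcf.
have natM : [set: nat] #< [set: M].
  exact: card_lt_le_trans natcf (card_leT _).
move: A p; apply: (compatible_subfamily_of_small natM).
  move=> A f MA.
  have [|||d _|J [JA MJ Jc]] := @cf_lift M I nat
    [set X | forall m n, X m -> X n -> m = n] A f cfinf.
  - by move=> X Y XY Yc m n /XY Ym /XY Yn; exact: Yc.
  - exact: MA.
  - exact: card_le_lt_trans (card_leT _) natM.
  - have [|n cfn] := @cf_fiber M nat d.
      exact: card_le_lt_trans (card_leT _) natcf.
    exists (cf M `&` d @^-1` [set n]); split=> //.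
    by move=> _ _ [? [_ ->] <-] [? [_ ->] <-].
  have [i Ji] := infinite_setN0 (infinite_card_le MJ (nat_lt_infinite natM)).
  exists (f i); apply: (card_le_trans MJ); apply: subset_card_le => j Jj.
  by split; [exact: JA|apply: Jc; [exists j|exists i]].
move=> A p MA pA pc; apply: cf_lift => //.
  by move=> X Y; exact: sub_compatible.
move=> d dA; apply: compatible_subfamily_cf => // m _.
by have [i Ai <-] := dA m; exact: pc.
Qed.

(** * Open subsets of function spaces *)

Section Cp_topology.
Context {R : realType} {X : topologicalType}.

(** The sets of functions [e]-close to [f] on [s] generate a filter that
    converges to [f] at every point, hence in the product topology; so it
    contains all neighbourhoods of [f]. *)
Lemma ptws_nbhs_finite (f : {ptws X -> R}) (V : set {ptws X -> R}) :
  nbhs f V -> exists (s : seq X) (e : R), 0 < e /\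
    forall g : {ptws X -> R}, (forall x, x \in s -> `|f x - g x| < e) -> V g.
Proof.
pose B (p : seq X * R) : set {ptws X -> R} :=
  [set g | forall x, x \in p.1 -> `|f x - g x| < p.2].
pose F := filter_from [set p : seq X * R | 0 < p.2] B.
have FF : Filter F.
  apply: filter_from_filter; first by exists ([::], 1) => /=.
  move=> [s d] [t e] /= d0 e0; exists (s ++ t, Num.min d e).
    by rewrite /= lt_min d0 e0.
  move=> g gst; split => x xs; have := gst x; rewrite /= mem_cat xs ?orbT;
  by move=> /(_ erefl); rewrite lt_min => /andP[].
suff Ff : F --> f.
  by move=> /Ff[[s e] /= e0 sV]; exists s, e; split => // g gs; exact: sV.
apply/cvg_sup => x; apply/cvg_image.
  rewrite eqEsubset; split => // y _; by exists (fun=> y).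
move=> W /= /nbhs_ballP[e /= e0 eW].
exists ((fun g : {ptws X -> R} => g x) @^-1` W).
  exists ([:: x], e) => //= g gx; apply: eW; rewrite -ball_normE /=.
  by apply: gx; rewrite mem_head.
rewrite eqEsubset; split=> [_ [g Wg <-]//|y Wy].
by exists (fun=> y).
Qed.

Lemma Cp_open_finite (U : set (Cp X R)) (f : Cp X R) : open U -> U f ->
  exists (s : seq X) (e : R), 0 < e /\
    forall g : Cp X R,
      (forall x, x \in s -> `|set_val f x - set_val g x| < e) -> U g.
Proof.
move=> [V Vo <-] Vf; have := open_nbhs_nbhs (conj Vo Vf).
move=> /ptws_nbhs_finite[s [e [e0 sV]]].
by exists s, e; split => // g; exact: sV.
Qed.

Lemma Cp_eval_open (x : X) (O : set R) : open O ->
  open [set f : Cp X R | O (set_val f x)].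
Proof.
move=> Oo; exists [set f : {ptws X -> R} | O (f x)] => //.
have pc : continuous (fun f : {ptws X -> R} => f x).
  exact: (@proj_continuous X (fun=> R) x).
exact: (iffLR (continuousP _) pc).
Qed.

Definition extendable (Y : set (seq (X * rat))) : Prop :=
  exists2 g : X -> R, continuous g &
    forall p, Y p -> forall x a, (x, a) \in p -> g x = ratr a.

(** Rational values make the finite data countable over each finite domain, at
    the price of moving away from the chosen element [f] of [U]. *)
Lemma Cp_open_data (U : set (Cp X R)) : open U -> U !=set0 ->
  exists p : seq (X * rat), compatible [set p] /\
    forall g : Cp X R,
      (forall x a, (x, a) \in p -> set_val g x = ratr a) -> U g.
Proof.
move=> Uo [f Uf]; have [s [e [e0 sU]]] := Cp_open_finite Uo Uf.
have rat_near x : exists q : rat, `|set_val f x - ratr q| < e.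
  have [|q] := @rat_in_itvoo R (set_val f x - e) (set_val f x + e).
    by rewrite ltrD2l gtrN.
  by rewrite in_itv /= -ltr_distl => qe; exists q; rewrite distrC.
have [q qP] := choice rat_near.
exists [seq (x, q x) | x <- s]; split.
  by move=> _ _ -> -> x a b /mapP[y _ [-> ->]] /mapP[z _ [-> ->]].
move=> g gq; apply: sU => x xs; rewrite (gq x (q x))//.
by apply/mapP; exists x.
Qed.

Lemma caliber_Cp (M : Type) :
    (forall (I : Type) (p : I -> seq (X * rat)), [set: I] #= [set: M] ->
      (forall i, compatible [set p i]) ->
      exists2 J, [set: M] #<= J & extendable (p @` J)) ->
  caliber M (Cp X R).
Proof.
move=> Mext I U IM Uo U0.
have [p pP] := choice (fun i => Cp_open_data (Uo i) (U0 i)).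
have [|J MJ [g gc gp]] := Mext I p IM; first by move=> i; have [] := pP i.
exists J; split.
  by rewrite card_eq_le MJ andbT -(card_le_eqr IM) card_leT.
exists (SigSub (mem_set gc) : Cp X R) => i Ji; apply: (pP i).2 => x a xa.
by apply: (gp (p i)) => //; exists i.
Qed.

Lemma nat_lt_cf_of_caliber (M : Type) (x0 : X) : infinite_set [set: M] ->
  caliber M (Cp X R) -> [set: nat] #< cf M.
Proof.
move=> Minf Mcal; apply/card_ltP => cfnat.
have [n [_ ninj]] := inj_of_card_le 0%N cfnat.
have [h hP] := @cf_above M.
pose O (m : M) : set R := ball ((n (h m))%:R : R) 2^-1.
have [|m|m|J [JM [f fJ]]] := Mcal M (fun m => [set f | O m (set_val f x0)]).
- exact: card_eqxx.
- by apply: Cp_eval_open; exact: ball_open.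
- have c : continuous ((fun=> (n (h m))%:R) : X -> R).
    by move=> y; exact: cvg_cst.
  exists (SigSub (mem_set c) : Cp X R).
  by apply: (@ballxx R R (n (h m))%:R); rewrite invr_gt0.
have close i j : J i -> J j -> (n (h i) <= n (h j))%N.
  move=> Ji Jj; rewrite -ltnS -(ltr_nat R) -natr1 -ltrBlDl.
  apply: le_lt_trans (ler_norm _) _.
  rewrite [ltRHS](_ : 1 = 2^-1 + 2^-1 :> R); last by rewrite -div1r -splitr.
  apply: (@ball_triangle _ _ (set_val f x0) _ _ _ _ (fJ i Ji)).
  exact/ball_sym/fJ.
have [m Jm] : J !=set0.
  by apply/infinite_setN0/infinite_card_le/Minf; rewrite (card_le_eqr JM).
apply: (full_not_le (x := h m) Minf JM) => k Jk /=.
have [[cfm _] [cfk kk]] := (hP m, hP k).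
rewrite (ninj (h m) (h k)) ?inE//.
by apply/eqP; rewrite eqn_leq !close.
Qed.

End Cp_topology.

(** * Function spaces over the one-point Lindelof extension *)

Section one_point_lindelof.
Context {R : realType} {L K : Type} (omegaL : [set: nat] #<= [set: L]).
Local Notation X := (one_point_lindelof K omegaL).
Local Notation infty := (None : X).

Lemma continuous_of_lt (g : X -> R) :
  [set x | g x <> g infty] #< [set: L] -> continuous g.
Proof.
move=> glt; apply/continuousP => O Oo; apply/one_point_lindelof_openE.
have [gO|gnO] := pselect (O (g infty)); last by left => -[x|//] _; exists x.
right; split => //; apply: card_le_lt_trans glt.
by apply: subset_card_le => x nOx gx; apply: nOx; rewrite /= gx.
Qed.

Lemma lt_of_continuous (g : X -> R) (O : set R) : continuous g -> open O ->
  O (g infty) -> [set x | ~ O (g x)] #< [set: L].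
Proof.
move=> /continuousP gc /gc/one_point_lindelof_openE[gO|[_ //]] gx.
by have [] := gO infty gx.
Qed.

Lemma extendable_of_domain_lt (Y : set (seq (X * rat))) :
  domain Y #< [set: L] -> compatible Y -> extendable (R := R) Y.
Proof.
move=> domL Yc.
have val_ex x : exists a, forall p b, Y p -> (x, b) \in p -> b = a.
  have [[p Yp [a xa]]|nx] := pselect (domain Y x).
    by exists a => q b Yq xb; exact: (Yc q p Yq Yp x b a xb xa).
  by exists 0 => p b Yp xb; exfalso; apply: nx; exists p => //; exists b.
have [v vP] := choice val_ex.
pose g x : R := if pselect (domain Y x) then ratr (v x) else ratr (v infty).
exists g; rewrite /g; last first.
  move=> p Yp x a xa; case: pselect => [?|nx]; first by rewrite -(vP x p a).
  by exfalso; apply: nx; exists p => //; exists a.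
apply: continuous_of_lt; apply: card_le_lt_trans domL.
apply: subset_card_le => x /=.
by case: pselect => // ?; case: pselect.
Qed.

Lemma extendable_of_lt (Y : set (seq (X * rat))) :
  [set: nat] #< [set: L] -> Y #< [set: L] -> compatible Y ->
  extendable (R := R) Y.
Proof.
by move=> natL YL; apply: extendable_of_domain_lt; exact: domain_lt.
Qed.

(** A single finite partial function extends even when lambda is omega, the case
    that [extendable_of_lt] leaves out. *)
Lemma extendable1 (p : seq (X * rat)) :
  compatible [set p] -> extendable (R := R) [set p].
Proof.
apply: extendable_of_domain_lt.
apply: finite_lt_infinite; last exact: (iffRL (infiniteP _) omegaL).
rewrite /domain bigcup_set1.
apply: sub_finite_set (finite_seq (map fst p)) => x [a xa] /=.
by apply/mapP; exists (x, a).
Qed.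

(** A continuous function that is above 1/2 at the points [h m], for [m] in [J],
    and below 1/2 at the added point would be away from its value there on at
    least lambda points. *)
Lemma not_caliber_of_map (M : Type) (h : M -> K) :
  (forall J : set M, J #= [set: M] -> [set: L] #<= h @` J) ->
  ~ caliber M (Cp X R).
Proof.
move=> hL Mcal.
pose lo : set R := [set r | r < 2^-1]; pose hi : set R := [set r | r > 2^-1].
have [|m|m|J [JM [f fJ]]] := Mcal M (fun m =>
    [set f | hi (set_val f (Some (h m) : X))] `&`
    [set f | lo (set_val f infty)]).
- exact: card_eqxx.
- by apply: openI; apply: Cp_eval_open; [exact: open_gt|exact: open_lt].
- pose g (x : X) : R := if pselect (x = Some (h m)) then 1 else 0.
  have c : continuous g.
    apply: continuous_of_lt.
    apply: finite_lt_infinite; last exact: (iffRL (infiniteP _) omegaL).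
    apply: (@sub_finite_set _ _ [set (Some (h m) : X)]) => //.
    by rewrite /g => x /=; case: pselect => //; case: pselect.
  exists (SigSub (mem_set c) : Cp X R); split.
    suff : 2^-1 < g (Some (h m)) by [].
    by rewrite /g; case: pselect => // ?; rewrite invf_lt1 ?ltr1n.
  suff : g infty < 2^-1 by [].
  by rewrite /g; case: pselect => // ?; rewrite invr_gt0.
have [m Jm] : J !=set0.
  have [u _] := infinite_setN0 (iffRL (infiniteP _) omegaL).
  apply/set0P/eqP => J0; have := hL _ JM.
  rewrite J0 image_set0 card_le0 => /eqP LT.
  by have : [set: L] u by []; rewrite LT.
have fc : continuous (set_val f : X -> R) by exact: set_mem (valP f).
have loo : open lo by exact: open_lt.
have /card_ltP := lt_of_continuous fc loo (fJ m Jm).2; apply.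
apply: (card_le_trans (hL _ JM)).
apply: (card_le_of_inj (f := fun k => Some k : X)); last by move=> x y _ _ [].
move=> _ [k Jk <-] /= /(lt_trans (fJ k Jk).1).
by rewrite ltxx.
Qed.

Lemma extendable_sub (Y Z : set (seq (X * rat))) :
  Y `<=` Z -> extendable (R := R) Z -> extendable (R := R) Y.
Proof. by move=> YZ [g gc gZ]; exists g => // p /YZ; exact: gZ. Qed.

Lemma card_seq_data : [set: L] #<= [set: K] ->
  [set: seq (X * rat)] #<= [set: K].
Proof.
move=> LK; have Kinf : infinite_set [set: K].
  exact: (infinite_card_le (card_le_trans omegaL LK) infinite_nat).
have -> : [set: seq (X * rat)] = seqs [set: X * rat] by apply/seteqP; split.
apply: card_seqs_le => //; rewrite -setXTT; apply: card_setX_le => //.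
- have -> : [set: X] = range (Some : K -> X) `|` [set infty].
    by apply/seteqP; split => // -[x _|_]; [left; exists x|right].
  apply: card_le_setU => //; first exact: card_image_le.
  exact/card_ltW/finite_lt_infinite.
- exact: card_le_trans (countableP _) (card_le_trans omegaL LK).
Qed.

(** There are at most kappa < cf(mu) finite partial functions, so a family of
    cf(mu) of them has one value repeated cf(mu) times, and a single finite
    partial function extends. *)
Lemma caliber_of_lt_cf (M : Type) : [set: L] #<= [set: K] ->
  [set: K] #< cf M -> caliber M (Cp X R).
Proof.
move=> LK Kcf; have natcf : [set: nat] #< cf M.
  exact: card_le_lt_trans (card_le_trans omegaL LK) Kcf.
have data I (A : set I) (p : I -> seq (X * rat)) : p @` A #< cf M.
  apply: card_le_lt_trans Kcf; apply: card_le_trans (card_seq_data LK).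
  exact: card_leT.
apply: caliber_Cp => I p IM pc.
have cfinf := nat_lt_infinite natcf.
have [|||d dp|J [_ MJ PJ]] :=
  @cf_lift M I _ (extendable (R := R)) setT p cfinf.
- exact: extendable_sub.
- by rewrite (card_le_eqr IM).
- exact: card_lt_le_trans (data _ _ _) (card_leT _).
- have [q cfq] := cf_fiber (data _ (cf M) d).
  exists (cf M `&` d @^-1` [set q]); split=> //.
  have [m [_ dmq]] := infinite_setN0 (infinite_card_le cfq cfinf).
  apply: (@extendable_sub _ [set q]); first by move=> _ [? [_ ->] <-].
  by apply: extendable1; rewrite -dmq; have [i _ <-] := dp m; exact: pc.
by exists J.
Qed.

(** Here any mu compatible functions have a continuous extension, as their
    domains cover fewer than lambda points. *)
Lemma caliber_of_lt (M : Type) : [set: nat] #< cf M -> [set: M] #< [set: L] ->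
  caliber M (Cp X R).
Proof.
move=> natcf ML; apply: caliber_Cp => I p IM pc.
have [||J [_ MJ Jc]] := compatible_subfamily (A := setT) (p := p) natcf.
- by rewrite (card_le_eqr IM).
- by move=> i _; exact: pc.
exists J => //; apply: extendable_of_lt => //.
  exact: card_lt_trans (card_lt_le_trans natcf (card_leT _)) ML.
apply: card_le_lt_trans ML; rewrite -(card_le_eqr IM).
exact: card_le_trans (card_image_le _ _) (card_leT _).
Qed.

(** The union of mu many domains may be too large for a continuous extension,
    but [cf_lift] only needs to extend cf(mu) < lambda functions at a time. *)
Lemma caliber_of_cf_lt (M : Type) : [set: L] #<= [set: K] ->
  [set: nat] #< cf M -> cf M #< [set: L] -> [set: K] #< [set: M] ->
  caliber M (Cp X R).
Proof.
move=> LK natcf cfL KM; apply: caliber_Cp => I p IM pc.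
have [|||d dp|J [_ MJ PJ]] :=
  @cf_lift M I _ (extendable (R := R)) setT p (nat_lt_infinite natcf).
- exact: extendable_sub.
- by rewrite (card_le_eqr IM).
- apply: card_le_lt_trans KM; apply: card_le_trans (card_seq_data LK).
  exact: card_leT.
- have [||J [Jcf cfJ Jc]] := compatible_subfamily_cf (A := cf M) (p := d) natcf.
  + exact: card_lexx.
  + by move=> m _; have [i _ <-] := dp m; exact: pc.
  exists J; split => //; apply: extendable_of_lt => //.
    exact: card_lt_trans natcf cfL.
  apply: card_le_lt_trans cfL; apply: card_le_trans (card_image_le _ _) _.
  exact: subset_card_le.
by exists J.
Qed.

Lemma caliber_not_between (M : Type) :
  caliber M (Cp X R) -> ~ ([set: L] #<= [set: M] /\ [set: M] #<= [set: K]).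
Proof.
move=> Mcal [LM MK].
have natK := card_le_trans (card_le_trans omegaL LM) MK.
have [u _] := infinite_setN0 (iffRL (infiniteP _) natK).
have [h [_ hi]] := inj_of_card_le u MK.
apply: not_caliber_of_map Mcal => // J JM; apply: (card_le_trans LM).
rewrite -(card_le_eql JM); apply: (card_le_of_inj (f := h)).
  by move=> x Jx; exists x.
by move=> x y _ _; apply: hi; rewrite inE.
Qed.

Lemma caliber_cf_not_between (M : Type) : infinite_set [set: M] ->
  caliber M (Cp X R) -> ~ ([set: L] #<= cf M /\ cf M #<= [set: K]).
Proof.
move=> Minf Mcal [Lcf cfK].
have natK := card_le_trans (card_le_trans omegaL Lcf) cfK.
have [u _] := infinite_setN0 (iffRL (infiniteP _) natK).
have [n [_ ni]] := inj_of_card_le u cfK.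
have [h hP] := @cf_above M.
apply: (@not_caliber_of_map _ (n \o h)) Mcal => J JM.
apply: (card_le_trans Lcf); apply: (@card_le_trans _ _ _ (h @` J)).
  apply: contrapT => /card_ltP /lt_cf_bounded[x xP].
  apply: (full_not_le (x := x) Minf JM) => m Jm /=.
  have [hx _] := xP (h m) (ex_intro2 _ _ m Jm erefl).
  exact: wo_trans (proj1 (card_orderP M)) (hP m).2 hx.
apply: (card_le_of_inj (f := n)) => [_ [m Jm <-]|x y].
  by exists m.
rewrite !inE => -[m _ <-] [k _ <-]; apply: ni; apply: mem_set.
  by have [] := hP m.
by have [] := hP k.
Qed.

End one_point_lindelof.

Theorem theorem6p6 (R : realType) (L K : Type)
    (omegaL : [set: nat] #<= [set: L]) (LK : [set: L] #<= [set: K]) :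
  (forall M : Type,
     calibers (Cp (one_point_lindelof K omegaL) R) M <->
     [\/ infinite_set [set: M] /\ [set: K] #< cf M,
         [/\ infinite_set [set: M], [set: nat] #< cf M &
             [set: M] #< [set: L]] |
         [/\ infinite_set [set: M], [set: nat] #< cf M,
             cf M #< [set: L] & [set: K] #< [set: M]]])
  /\
  (forall M : Type, infinite_set [set: M] ->
     (caliber M (Cp (one_point_lindelof K omegaL) R) <->
      [/\ [set: nat] #< cf M,
          ~ ([set: L] #<= [set: M] /\ [set: M] #<= [set: K]) &
          ~ ([set: L] #<= cf M /\ cf M #<= [set: K])])).
Proof.
pose X := one_point_lindelof K omegaL.
have nec M : infinite_set [set: M] -> caliber M (Cp X R) ->
    [/\ [set: nat] #< cf M,
        ~ ([set: L] #<= [set: M] /\ [set: M] #<= [set: K]) &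
        ~ ([set: L] #<= cf M /\ cf M #<= [set: K])].
  move=> Minf Mcal; split; last exact: (caliber_cf_not_between Minf Mcal).
    exact: (nat_lt_cf_of_caliber (None : X) Minf Mcal).
  exact: (caliber_not_between Mcal).
have suf M : [\/ infinite_set [set: M] /\ [set: K] #< cf M,
      [/\ infinite_set [set: M], [set: nat] #< cf M & [set: M] #< [set: L]] |
      [/\ infinite_set [set: M], [set: nat] #< cf M,
          cf M #< [set: L] & [set: K] #< [set: M]]] ->
    caliber M (Cp X R).
  case=> [[_ Kcf]|[_ natcf ML]|[_ natcf cfL KM]].
  - exact: caliber_of_lt_cf.
  - exact: caliber_of_lt.
  - exact: caliber_of_cf_lt.
have classify M : infinite_set [set: M] ->
    [/\ [set: nat] #< cf M,
        ~ ([set: L] #<= [set: M] /\ [set: M] #<= [set: K]) &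
        ~ ([set: L] #<= cf M /\ cf M #<= [set: K])] ->
    [\/ infinite_set [set: M] /\ [set: K] #< cf M,
      [/\ infinite_set [set: M], [set: nat] #< cf M & [set: M] #< [set: L]] |
      [/\ infinite_set [set: M], [set: nat] #< cf M,
          cf M #< [set: L] & [set: K] #< [set: M]]].
  move=> Minf [natcf nM ncf].
  have [LM|/card_ltP ML] := pselect ([set: L] #<= [set: M]).
    2: by apply: Or32.
  have KM : [set: K] #< [set: M] by apply/card_ltP => MK; apply: nM.
  have [Lcf|/card_ltP cfL] := pselect ([set: L] #<= cf M); last by apply: Or33.
  by apply: Or31; split => //; apply/card_ltP => cfK; apply: ncf.
split=> [M|M Minf]; split.
- by move=> [Minf Mcal]; apply: classify => //; exact: nec.
- by move=> cls; split; last exact: suf; case: cls => [[]|[]|[]].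
- exact: nec.
- by move=> /(classify M Minf)/suf.
Qed.
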